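(* Let $c>0$ be fixed, let $k\in\mathbb{N}$, and let $\phi_k(x)=(x^2+c^2)^{k-1/2}$ be the $k$-th order multiquadric. Let $\{x_j\}_{j\in\mathbb{Z}}\subset\mathbb{R}$ be a scattered sequence. Then for every $\epsilon>0$ and every continuous function $f:[a,b]\to\mathbb{R}$ there exist $N\in\mathbb{N}$ and real coefficients $a_1,\dots,a_N$ such that \[ \sup_{x\in[a,b]}\left|f(x)-\sum_{j=1}^{N}a_j\phi_k(x-x_j)\right|<\epsilon . \]
   Context: A sequence $\mathcal{X}$ of real numbers is $\delta$-separated if $\inf_{x,y\in\mathcal{X},\,x\neq y}|x-y|=\delta>0$. A sequence $\{x_j\}_{j\in\mathbb{Z}}\subset\mathbb{R}$ is called scattered if it is $\delta$-separated for some $\delta>0$ and $\lim_{j\to\pm\infty}x_j=\pm\infty$. *)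

(* Defs.v *)
From HB Require Import structures.
From mathcomp Require Import all_boot all_order all_algebra.
From mathcomp Require Import all_classical all_reals all_analysis.
Set Implicit Arguments. Unset Strict Implicit. Unset Printing Implicit Defensive.
Import Order.TTheory GRing.Theory Num.Theory.
Import numFieldNormedType.Exports.
Local Open Scope classical_set_scope.
Local Open Scope ring_scope.

Definition multiquadric {R : realType} (c : R) (k : nat) (x : R) : R :=
  powR (x ^+ 2 + c ^+ 2) (k%:R - 2^-1).

Definition separated {R : realType} (x : int -> R) : Prop :=
  exists2 delta : R, 0 < delta &
    forall i j : int, x i != x j -> delta <= `|x i - x j|.

Definition scattered {R : realType} (x : int -> R) : Prop :=
  [/\ separated x,
      (fun n : nat => x n%:Z) @ \oo --> +oo
    & (fun n : nat => x (- n%:Z)) @ \oo --> -oo].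

(* Main.v *)
Require Import Defs.
From HB Require Import structures.
From mathcomp Require Import all_boot all_order all_algebra.
From mathcomp Require Import all_classical all_reals all_analysis.
From mathcomp Require Import ring lra zify.
Import Order.TTheory GRing.Theory Num.Theory.
Import numFieldNormedType.Exports.
Local Open Scope classical_set_scope.
Local Open Scope ring_scope.

(** Only the nodes [x_j] with [j >= 1] are needed.  With [s = 1 / x_j], the function
    [s^(2k-1) phi_k(t - 1/s) = (1 - ts)^(2k-1) (1 + (cs / (1 - ts))^2)^(k-1/2)]
    has an expansion in powers of [s], uniform for [t] in a bounded interval, whose
    coefficients are polynomials in [t].  Letting [s] tend to 0 along the nodes puts
    every coefficient in the uniform closure of the span.  The coefficient of
    [s^(2k+n)] has degree exactly [n], its leading term being
    [binom(k-1/2, k) c^(2k) t^n], and this is nonzero since [k-1/2] is not a natural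
    number.  Hence all monomials lie in the closure, and Weierstrass' theorem
    concludes. *)

(** * The binomial expansion with remainder *)

(** The generalized binomial coefficient a(a-1)...(a-i+1)/i!. Peeling off [a / i] and lowering [a]
    makes differentiation of the truncated series turn exponent [a] into [a - 1]. *)
Fixpoint gbinom {R : realType} (a : R) (i : nat) : R :=
  if i is i'.+1 then a / i%:R * gbinom (a - 1) i' else 1.

Lemma gbinom_neq0 {R : realType} (a : R) (i : nat) :
  (forall j : nat, a != j%:R) -> gbinom a i != 0.
Proof.
elim: i a => [|i IHi] a aN /=; first exact: oner_neq0.
rewrite !mulf_neq0 ?invr_eq0 ?pnatr_eq0//; first exact: (aN 0%N).
by apply: IHi => j; rewrite subr_eq natr1.
Qed.

Lemma deriv_gbinom_poly {R : realType} (a : R) (n : nat) :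
  (\poly_(i < n.+1) gbinom a i)^`() = a *: \poly_(i < n) gbinom (a - 1) i.
Proof.
apply/polyP => i; rewrite coef_deriv coefZ !coef_poly ltnS.
case: ifP => _; last by rewrite mul0rn mulr0.
by rewrite -mulr_natl /=; field; rewrite addrC natr1 pnatr_eq0.
Qed.

(* By induction on the order: the remainder of order [n.+1] and exponent [a] is
   the primitive of [a] times the one of order [n] and exponent [a - 1]. *)
Lemma powR1D_taylor {R : realType} (n : nat) (a : R) : exists C : R,
  forall w, 0 <= w <= 1 ->
    `|(1 + w) `^ a - (\poly_(i < n) gbinom a i).[w]| <= C * w ^+ n.
Proof.
elim: n a => [|n IHn] a.
  (* As 1 <= 1 + w <= 2, replacing [a] by [|a|] only increases the power, which is then largest at w
     = 1. *)
  exists (2 `^ `|a|) => w /andP[w0 w1].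
  rewrite poly_def big_ord0 horner0 subr0 expr0 mulr1 ger0_norm ?powR_ge0//.
  apply: (@le_trans _ _ ((1 + w) `^ `|a|)).
    by rewrite ler_powR ?lerDl// ler_norm.
  by rewrite ge0_ler_powR ?nnegrE ?addr_ge0//; lra.
have [C CP] := IHn (a - 1); exists (`|a| * C) => w /andP[w0 w1].
pose F z := (1 + z) `^ a - (\poly_(i < n.+1) gbinom a i).[z].
pose dF z := a * ((1 + z) `^ (a - 1) - (\poly_(i < n) gbinom (a - 1) i).[z]).
have FdF (z : R) : 0 <= z -> is_derive z 1 F (dF z).
  move=> z0.
  have D1 : is_derive z 1 (fun z : R => 1 + z) 1.
    by apply: is_derive_eq; rewrite add0r mulr1.
  have D2 : is_derive (1 + z) 1 (fun y : R => y `^ a) (a * (1 + z) `^ (a - 1)).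
    by apply: is_derive1_powR; lra.
  have D3 := is_derive1_comp D2 D1.
  have D4 := is_derive_poly (\poly_(i < n.+1) gbinom a i) z.
  apply: is_derive_eq.
  by rewrite deriv_gbinom_poly hornerZ /dF mulr1 mulrBr.
(* Since F 0 = 0, the mean value theorem gives F w = dF z * w with 0 <= z <= w, and z^n <= w^n
   supplies the other n powers of w. *)
have [||z zw FE] := @MVT_segment R F dF 0 w w0.
- by move=> z; rewrite in_itv/= => /andP[/ltW/FdF].
- apply: derivable_within_continuous => z; rewrite in_itv/= => /andP[/FdF].
  by case.
have /andP[z0 zlew] : 0 <= z <= w by rewrite in_itv in zw.
have F0 : F 0 = 0.
  by rewrite /F addr0 powR1 horner_coef0 coef_poly/= subrr.
rewrite -[X in `|X|]/(F w) -[F w]subr0 -F0 FE subr0 /dF normrM normrM.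
rewrite exprSr mulrA (ger0_norm w0) ler_wpM2r// -mulrA ler_wpM2l//.
(* The bound at w = 1 forces [C] to be nonnegative. *)
have C0 : 0 <= C by have := CP 1; rewrite ler01 lexx expr1n mulr1 => /(_ isT); apply: le_trans.
apply: (le_trans (CP z _)); first by lra.
by rewrite ler_wpM2l// lerXn2r.
Qed.

(** * Bernstein polynomials *)

Definition bernstein_weight {R : realType} (n i : nat) (u : R) : R :=
  u ^+ i * (1 - u) ^+ (n - i) *+ 'C(n, i).

Lemma bernstein_weight_ge0 {R : realType} (n i : nat) (u : R) :
  0 <= u <= 1 -> 0 <= bernstein_weight n i u.
Proof.
by case/andP=> u0 u1; rewrite mulrn_wge0// mulr_ge0// exprn_ge0// subr_ge0.
Qed.

(** This is the generating function of the binomial law; its value and first two derivatives at 1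
    give the total mass, the mean and the second factorial moment below. *)
Lemma bernstein_pgf {R : realType} (n : nat) (u : R) :
  \sum_(i < n.+1) bernstein_weight n i u *: 'X^i = ((1 - u)%:P + u *: 'X) ^+ n.
Proof.
rewrite exprDn; apply: eq_bigr => i _.
by rewrite -polyC_exp exprZn -scalerAr mul_polyC scalerA scalerMnl.
Qed.

Lemma sum_bernstein_weight {R : realType} (n : nat) (u : R) :
  \sum_(i < n.+1) bernstein_weight n i u = 1.
Proof.
have := congr1 (horner^~ 1) (bernstein_pgf n u).
rewrite /= horner_sum !hornerE subrK expr1n => <-.
by apply: eq_bigr => i _; rewrite !hornerE expr1n mulr1.
Qed.

Lemma sum_bernstein_weightM {R : realType} (n : nat) (u : R) :
  \sum_(i < n.+1) bernstein_weight n i u * i%:R = u * n%:R.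
Proof.
have := congr1 (fun p : {poly R} => p^`().[1]) (bernstein_pgf n u).
rewrite /= raddf_sum horner_sum deriv_exp derivD derivC derivZ derivX add0r.
rewrite hornerMn !hornerE subrK expr1n mulr1 mulr_natr => <-.
apply: eq_bigr => i _ /=; rewrite derivZ derivXn hornerZ hornerMn hornerXn expr1n.
by [].
Qed.

Lemma sum_bernstein_weightM2 {R : realType} (n : nat) (u : R) :
  \sum_(i < n.+1) bernstein_weight n i u * (i * i.-1)%:R =
  u ^+ 2 * (n * n.-1)%:R.
Proof.
have := congr1 (fun p : {poly R} => p^`()^`().[1]) (bernstein_pgf n u).
rewrite /= !raddf_sum horner_sum deriv_exp derivD derivC derivZ derivX add0r.
rewrite derivMn -scalerAl mul1r derivZ deriv_exp derivD derivC derivZ derivX add0r.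
rewrite hornerMn hornerZ hornerMn !hornerE subrK expr1n !mulr1.
move=> H; transitivity (u * (u *+ n.-1) *+ n); last first.
  by rewrite mulr_natr mulrnAr -mulrnA -expr2 mulnC.
rewrite -H.
apply: eq_bigr => i _ /=; rewrite !(derivZ,derivXn,derivMn).
by rewrite !(hornerZ,hornerMn,hornerXn) expr1n -mulrnA mulnC.
Qed.

Lemma bernstein_variance {R : realType} (n : nat) (u : R) :
  \sum_(i < n.+1) bernstein_weight n i u * (i%:R - n%:R * u) ^+ 2 =
  n%:R * (u * (1 - u)).
Proof.
have natE (m : nat) : (m * m.-1)%:R = m%:R ^+ 2 - m%:R :> R.
  by case: m => [|m]; rewrite ?expr0n ?subr0//= natrM -natr1; ring.
(* Uses (i - nu)^2 = i(i-1) + (1 - 2nu) i + (nu)^2. *)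
transitivity (\sum_(i < n.+1) bernstein_weight n i u * (i * i.-1)%:R
   + (1 - 2 * n%:R * u) * (\sum_(i < n.+1) bernstein_weight n i u * i%:R)
   + (n%:R * u) ^+ 2 * \sum_(i < n.+1) bernstein_weight n i u).
  rewrite !mulr_sumr -!big_split/=; apply: eq_bigr => i _.
  by rewrite natE; ring.
rewrite sum_bernstein_weightM2 sum_bernstein_weightM sum_bernstein_weight natE.
ring.
Qed.

(** Heine-Cantor: continuity gives the estimate for all points near a given [s] and all small [d],
    and compactness in its near-covering form makes [d] uniform. *)
Lemma segment_unif_continuous {R : realType} (a b : R) (f : R -> R) (eps : R) :
  {within `[a, b], continuous f} -> 0 < eps ->
  exists2 d : R, 0 < d & forall s t, s \in `[a, b] -> t \in `[a, b] ->
    `|s - t| < d -> `|f s - f t| < eps.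
Proof.
move=> /subspace_continuousP fc e0.
have /compact_near_coveringP/near_covering_withinP := @segment_compact R a b.
move=> /(_ R (0^'+) (fun d s => forall t, t \in `[a, b] ->
    `|s - t| < d -> `|f s - f t| < eps) _) H.
have : \forall d \near 0^'+, `[a, b] `<=` (fun s => forall t, t \in `[a, b] ->
    `|s - t| < d -> `|f s - f t| < eps).
  apply: H => s sab.
  have := fc s sab => /cvgrPdist_lt/(_ (eps / 2)).
  rewrite divr_gt0// => /(_ isT)/nbhs_ballP[r /= r0 rP].
  have r20 : 0 < r / 2 by rewrite divr_gt0.
  near=> s' d => s'ab t tab std.
  have d_lt : d < r / 2 by near: d; exact: nbhs_right_lt.
  have ss' : `|s - s'| < r / 2 by near: s'; exact: (nbhsx_ballx _ _ r20).
  have H1 : `|f s - f s'| < eps / 2.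
    by apply: rP => //=; apply: (lt_trans ss'); lra.
  have H2 : `|f s - f t| < eps / 2.
    apply: rP => //=; apply: (le_lt_trans (ler_distD s' _ _)).
    rewrite [r]splitr ltrD//; exact: lt_trans std d_lt.
  by have := ler_distD (f s) (f s') (f t); rewrite (distrC (f s') (f s)); lra.
move=> {}H.
have [d /= [d0 dP]] := @filter_ex _ (0^'+) _ _ (filterI (nbhs_right_gt (0:R)) H).
by exists d => // s t sab tab std; apply: dP.
Unshelve. all: by end_near.
Qed.

Lemma weierstrass {R : realType} (a b : R) (f : R -> R) (eps : R) :
  {within `[a, b], continuous f} -> 0 < eps ->
  exists p : {poly R}, forall t, t \in `[a, b] -> `|f t - p.[t]| <= eps.
Proof.
move=> fc e0; have [ba|ab] := leP b a.
  exists (f a)%:P => t; rewrite in_itv/= hornerC => /andP[at_ tb].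
  by have -> : t = a; [apply/le_anti; rewrite at_ (le_trans tb)|rewrite subrr normr0 ltW].
have [d d0 dP] : exists2 d : R, 0 < d & forall s t, s \in `[a, b] -> t \in `[a, b] ->
    `|s - t| < d -> `|f s - f t| < eps / 2.
  by apply: segment_unif_continuous; rewrite ?divr_gt0.
have [M M0 MP] : exists2 M : R, 0 <= M &
    forall s t, s \in `[a, b] -> t \in `[a, b] -> `|f s - f t| <= M.
  have [x xab xP] := EVT_max (ltW ab) fc.
  have [y yab yP] := EVT_min (ltW ab) fc.
  exists (f x - f y) => [|s t sab tab]; first by rewrite subr_ge0 xP.
  rewrite ler_norml; have := xP s sab; have := xP t tab.
  by have := yP s sab; have := yP t tab; lra.
have ba0 : 0 < b - a by rewrite subr_gt0.
(* Chebyshev's constant: M((t - v_i)/d)^2 equals (A/n^2)(i - nu)^2, so the variance controls the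
   nodes far from [t]. *)
pose A := M * (b - a) ^+ 2 / d ^+ 2.
have A0 : 0 <= A by rewrite divr_ge0 ?mulr_ge0 ?exprn_ge0// ltW.
have [n nA n0] : exists2 n : nat, A / (eps / 2) < n%:R & (0 < n)%N.
  exists (Num.bound (A / (eps / 2))).+1 => //.
  have /archi_boundP H : 0 <= A / (eps / 2) by rewrite divr_ge0// ltW ?divr_gt0.
  by apply: (lt_trans H); rewrite ltr_nat.
have nR0 : 0 < n%:R :> R by rewrite ltr0n.
pose v (i : nat) := a + i%:R / n%:R * (b - a).
pose U : {poly R} := (b - a)^-1 *: ('X - a%:P).
exists (\sum_(i < n.+1) (f (v i) *+ 'C(n, i)) *: (U ^+ i * (1 - U) ^+ (n - i))).
move=> t tab; pose u := (t - a) / (b - a).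
have u01 : 0 <= u <= 1.
  move: tab; rewrite in_itv/= => /andP[at_ tb].
  by rewrite /u divr_ge0 ?subr_ge0 ?(ltW ab)//= ler_pdivrMr// mul1r lerD2r.
have -> : (\sum_(i < n.+1) (f (v i) *+ 'C(n, i)) *:
    (U ^+ i * (1 - U) ^+ (n - i))).[t] =
    \sum_(i < n.+1) bernstein_weight n i u * f (v i).
  rewrite horner_sum; apply: eq_bigr => i _.
  rewrite hornerZ hornerM !horner_exp hornerD hornerN hornerC hornerZ hornerXsubC.
  rewrite /bernstein_weight (mulrC (b - a)^-1) -/u.
  by rewrite [RHS]mulrC mulrnAr mulrnAl.
rewrite -[f t]mul1r -(sum_bernstein_weight n u) mulr_suml -sumrB.
apply: (le_trans (ler_norm_sum _ _ _)).
(* Nodes within [d] of [t] cost at most eps/2 by uniform continuity; at the others ((t - v_i)/d)^2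
   >= 1 absorbs the oscillation bound [M]. *)
apply: (@le_trans _ _ (\sum_(i < n.+1) bernstein_weight n i u *
    (eps / 2 + A / n%:R ^+ 2 * (i%:R - n%:R * u) ^+ 2))).
  apply: ler_sum => i _; rewrite -mulrBr normrM ger0_norm ?bernstein_weight_ge0//.
  apply: ler_wpM2l; first exact: bernstein_weight_ge0.
  have vab : v i \in `[a, b].
    rewrite in_itv/= /v lerDl mulr_ge0 ?divr_ge0//= ?(ltW ba0)//.
    rewrite -lerBrDl ler_piMl ?(ltW ba0)// ler_pdivrMr// mul1r ler_nat.
    by rewrite -ltnS.
  have E : A / n%:R ^+ 2 * (i%:R - n%:R * u) ^+ 2 = M * ((t - v i) / d) ^+ 2.
    rewrite /A /v /u; field.
    by rewrite ?(gt_eqF d0) ?(gt_eqF nR0) ?(gt_eqF ba0).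
  rewrite E; have [td|td] := ltP `|t - v i| d.
    apply: (le_trans (ltW (dP _ _ tab vab td))).
    by rewrite lerDl mulr_ge0// sqr_ge0.
  apply: (le_trans (MP _ _ tab vab)).
  rewrite -[X in X <= _]add0r lerD ?divr_ge0 ?(ltW e0)// ler_peMr//.
  rewrite -real_normK ?num_real// exprn_ege1// normrM normfV (gtr0_norm d0).
  by rewrite ler_pdivlMr// mul1r.
under eq_bigr do rewrite mulrDr (mulrCA _ (A / n%:R ^+ 2)).
rewrite big_split/= -mulr_suml sum_bernstein_weight mul1r -mulr_sumr.
rewrite bernstein_variance [leRHS]splitr lerD2l.
have -> : A / n%:R ^+ 2 * (n%:R * (u * (1 - u))) = A / n%:R * (u * (1 - u)).
  by field; rewrite gt_eqF.
apply: (@le_trans _ _ (A / n%:R)).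
  case/andP: u01 => u0 u1; apply: ler_piMr; first exact: divr_ge0 A0 (ltW nR0).
  by rewrite mulr_ile1 ?subr_ge0// gerBl.
by move: nA; rewrite ltr_pdivrMr ?divr_gt0// ler_pdivrMr// mulrC => /ltW.
Qed.

(** * Uniform closure of a linear span *)

Definition span_closure {R : realType} {T : Type} (e : nat -> T -> R) (D : set T)
    (h : T -> R) : Prop :=
  forall eps, 0 < eps -> exists (N : nat) (coef : nat -> R),
    forall t, D t -> `|h t - \sum_(j < N) coef j * e j t| <= eps.

Section SpanClosure.
Context {R : realType} {T : Type} (e : nat -> T -> R) (D : set T).
Local Notation W := (span_closure e D).

Lemma span_closure_limit (h : T -> R) :
  (forall eps, 0 < eps ->
    exists2 g, W g & forall t, D t -> `|h t - g t| <= eps) -> W h.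
Proof.
move=> H eps e0; have e20 : 0 < eps / 2 by rewrite divr_gt0.
have [g /(_ _ e20)[N [coef gP]] hg] := H _ e20.
exists N, coef => t Dt; apply: (le_trans (ler_distD (g t) _ _)).
by rewrite [leRHS]splitr lerD ?hg ?gP.
Qed.

Lemma eq_span_closure (g h : T -> R) :
  (forall t, D t -> h t = g t) -> W g -> W h.
Proof.
move=> gh Wg; apply: span_closure_limit => eps e0; exists g => // t Dt.
by rewrite gh// subrr normr0 ltW.
Qed.

Lemma span_closure_gen (j : nat) : W (e j).
Proof.
move=> eps e0; exists j.+1, (fun i => (i == j)%:R) => t _.
rewrite big_ord_recr/= eqxx mul1r big1 ?add0r ?subrr ?normr0 ?ltW// => i _.
by rewrite ltn_eqF ?mul0r.
Qed.

Lemma span_closure0 : W (fun=> 0).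
Proof.
by move=> eps e0; exists 0%N, (fun=> 0) => t _; rewrite big_ord0 subrr normr0 ltW.
Qed.

Lemma span_closureZ (r : R) (h : T -> R) : W h -> W (fun t => r * h t).
Proof.
move=> Wh eps e0.
(* Dividing by |r| + 1 instead of |r| covers r = 0. *)
have [N [coef hP]] := Wh _ (divr_gt0 e0 (ltr_pwDr ltr01 (normr_ge0 r))).
exists N, (fun j => r * coef j) => t Dt.
under eq_bigr do rewrite -mulrA.
rewrite -mulr_sumr -mulrBr normrM.
apply: (@le_trans _ _ ((`|r| + 1) * (eps / (`|r| + 1)))).
  by rewrite ler_pM// ?lerDl// hP.
by rewrite mulrCA divff ?mulr1// gt_eqF// ltr_pwDr.
Qed.

Lemma sum_truncated_coef (N M : nat) (coef : nat -> R) (t : T) : (N <= M)%N ->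
  \sum_(j < M) (if (j < N)%N then coef j else 0) * e j t =
  \sum_(j < N) coef j * e j t.
Proof.
move=> NM; rewrite (big_ord_widen M (fun j => coef j * e j t))//.
by rewrite [RHS]big_mkcond; apply: eq_bigr => i _; case: ifP; rewrite ?mul0r.
Qed.

Lemma span_closureD (g h : T -> R) : W g -> W h -> W (fun t => g t + h t).
Proof.
move=> Wg Wh eps e0; have e20 : 0 < eps / 2 by rewrite divr_gt0.
have [N [a gP]] := Wg _ e20; have [M [b hP]] := Wh _ e20.
exists (maxn N M), (fun j => (if (j < N)%N then a j else 0) +
  (if (j < M)%N then b j else 0)) => t Dt.
under eq_bigr do rewrite mulrDl.
rewrite big_split/= !sum_truncated_coef ?leq_maxl ?leq_maxr// opprD addrACA.
by rewrite (le_trans (ler_normD _ _))// [leRHS]splitr lerD ?gP ?hP.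
Qed.

Lemma span_closure_sum (I : Type) (r : seq I) (P : pred I) (F : I -> T -> R) :
  (forall i, P i -> W (F i)) -> W (fun t => \sum_(i <- r | P i) F i t).
Proof.
move=> WF; elim: r => [|i r IHr].
  by apply: (eq_span_closure _ _ _ span_closure0) => t _; rewrite big_nil.
have [Pi|Pi] := boolP (P i); last first.
  by apply: (eq_span_closure _ _ _ IHr) => t _; rewrite big_cons (negbTE Pi).
apply: (eq_span_closure _ _ _ (span_closureD _ _ (WF i Pi) IHr)) => t _.
by rewrite big_cons Pi.
Qed.

End SpanClosure.

(** * Coefficients of expansions in a small parameter *)

Lemma poly_bounded {R : realType} (B : R) (p : {poly R}) :
  exists2 C, 0 <= C & forall t, `|t| <= B -> `|p.[t]| <= C.
Proof.
elim/poly_ind: p => [|p r [C C0 CP]].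
  by exists 0 => // t _; rewrite horner0 normr0.
exists (C * `|B| + `|r|) => [|t tB]; first by rewrite addr_ge0 ?mulr_ge0.
rewrite hornerMXaddC (le_trans (ler_normD _ _))// lerD2r normrM ler_pM ?CP//.
by rewrite (le_trans tB)// ler_norm.
Qed.

(** In [{poly {poly R}}] the outer variable is the small parameter s and the coefficients are
    polynomials in t. *)
Lemma poly2_bounded {R : realType} (B : R) (Q : {poly {poly R}}) :
  exists2 C, 0 <= C &
    forall s t, 0 <= s <= 1 -> `|t| <= B -> `|Q.[s%:P].[t]| <= C.
Proof.
elim/poly_ind: Q => [|Q p [C C0 CP]].
  by exists 0 => // s t _ _; rewrite !horner0 normr0.
have [K K0 KP] := poly_bounded B p.
exists (C + K) => [|s t s01 tB]; first by rewrite addr_ge0.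
rewrite hornerMXaddC hornerD hornerM hornerC (le_trans (ler_normD _ _))//.
rewrite lerD ?KP// normrM -[C]mulr1 ler_pM ?CP//.
by case/andP: s01 => s0 s1; rewrite ger0_norm.
Qed.

(* The constant coefficient is the limit of the approximants as [s] tends to 0;
   subtracting it and dividing by [s] shifts the expansion by one. *)
Lemma span_closure_coef {R : realType} (e : nat -> R -> R) (B C : R) (L : nat)
    (Q : {poly {poly R}}) :
  0 <= C ->
  (forall d, 0 < d -> exists s (G : R -> R),
    [/\ 0 < s < d, span_closure e [set t | `|t| <= B] G &
      forall t, `|t| <= B -> `|G t - Q.[s%:P].[t]| <= C * s ^+ L]) ->
  forall m, (m < L)%N -> span_closure e [set t | `|t| <= B] (horner Q`_m).
Proof.
move=> C0; elim: L Q => [//|L IHL] Q H.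
have [Q' [p QE]] : exists Q' p, Q = Q' * 'X + p%:P.
  elim/poly_ind: Q {H} => [|Q p _]; last by exists Q, p.
  by exists 0, 0; rewrite mul0r add0r.
have [K K0 KP] := poly2_bounded B Q'.
have Wp : span_closure e [set t | `|t| <= B] (horner p).
  apply: span_closure_limit => eps e0.
  have CK : 0 < C + K + 1 by rewrite ltr_pwDr ?addr_ge0.
  (* For s < 1 the distance from [G] to [p] is at most (C + K)s; the added 1 keeps the denominator
     positive. *)
  have [|s [G [/andP[s0]]]] := H (Num.min 1 (eps / (C + K + 1))).
    by rewrite lt_min ltr01 divr_gt0.
  rewrite lt_min => /andP[s1 se] WG GP; exists G => // t tB.
  rewrite distrC; have := GP t tB; rewrite QE hornerMXaddC hornerD hornerM hornerC.
  move=> {}GP; have Qb : `|Q'.[s%:P].[t]| <= K by rewrite KP// !ltW.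
  have -> : G t - p.[t] =
    (G t - (Q'.[s%:P].[t] * s + p.[t])) + Q'.[s%:P].[t] * s by ring.
  apply: (le_trans (ler_normD _ _)).
  apply: (@le_trans _ _ (C * s + K * s)).
    apply: lerD; last by rewrite normrM (gtr0_norm s0) ler_wpM2r// ltW.
    apply: (le_trans GP); rewrite ler_wpM2l// exprS ler_piMr ?(ltW s0)//.
    by rewrite exprn_ile1 ?ltW.
  rewrite -mulrDl; move: se; rewrite ltr_pdivlMr// => se.
  by apply: ltW; apply: le_lt_trans se; rewrite mulrC ler_wpM2l ?(ltW s0)// lerDl.
case=> [|m mL].
  by rewrite QE coefD coefMX coefC/= add0r.
rewrite QE coefD coefMX coefC/= addr0; apply: IHL => // d d0.
have [s [G [/andP[s0 sd] WG GP]]] := H d d0.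
exists s, (fun t => s^-1 * (G t + -1 * p.[t])); split; first by rewrite s0.
  by apply: span_closureZ; apply: span_closureD => //; apply: span_closureZ.
move=> t tB; have := GP t tB; rewrite QE hornerMXaddC hornerD hornerM hornerC => {}GP.
have -> : s^-1 * (G t + -1 * p.[t]) - Q'.[s%:P].[t] =
  s^-1 * (G t - (Q'.[s%:P].[t] * s + p.[t])) by field; rewrite gt_eqF.
rewrite normrM gtr0_norm ?invr_gt0// mulrC ler_pdivrMr//.
by rewrite -mulrA -exprSr.
Qed.

(** * Expansion of the multiquadric at infinity *)

(** A pair [z] is (s, t): [z.1] is the small parameter, and the constant is uniform in t = [z.2]. *)
Definition bigO_on {R : realType} (E : set (R * R)) (L : nat) (F : R * R -> R) :=
  exists C, forall z, E z -> `|F z| <= C * z.1 ^+ L.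

Section BigO.
Context {R : realType} (E : set (R * R)).
Hypothesis E01 : forall z, E z -> 0 < z.1 <= 1.
Local Notation O := (bigO_on E).

Lemma eq_bigO_on (L : nat) (F G : R * R -> R) :
  (forall z, E z -> F z = G z) -> O L F -> O L G.
Proof. by move=> FG [C CP]; exists C => z Ez; rewrite -FG ?CP. Qed.

Lemma bigO_onW (L M : nat) (F : R * R -> R) : (M <= L)%N -> O L F -> O M F.
Proof.
move=> ML [C CP]; exists `|C| => z Ez; have /andP[z0 z1] := E01 _ Ez.
apply: (le_trans (CP z Ez)).
apply: (@le_trans _ _ (`|C| * z.1 ^+ L)).
  by rewrite ler_wpM2r ?ler_norm// exprn_ge0// ltW.
by rewrite ler_wpM2l// ler_wiXn2l// ltW.
Qed.

Lemma bigO_onD (L : nat) (F G : R * R -> R) :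
  O L F -> O L G -> O L (fun z => F z + G z).
Proof.
move=> [C CP] [K KP]; exists (C + K) => z Ez.
by rewrite mulrDl (le_trans (ler_normD _ _))// lerD ?CP ?KP.
Qed.

Lemma bigO_onM (L M : nat) (F G : R * R -> R) :
  O L F -> O M G -> O (L + M) (fun z => F z * G z).
Proof.
move=> [C CP] [K KP]; exists (C * K) => z Ez.
by rewrite normrM exprD mulrACA ler_pM ?CP ?KP.
Qed.

Lemma bigO_on_cst (r : R) : O 0 (fun=> r).
Proof. by exists `|r| => z _; rewrite expr0 mulr1. Qed.

Lemma bigO_on_sum (L : nat) (I : Type) (r : seq I) (P : pred I)
    (F : I -> R * R -> R) :
  (forall i, P i -> O L (F i)) -> O L (fun z => \sum_(i <- r | P i) F i z).
Proof.
move=> FO; elim: r => [|i r [C CP]].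
  by exists 0 => z _; rewrite big_nil normr0 mul0r.
have [Pi|Pi] := boolP (P i); last first.
  by exists C => z Ez; rewrite big_cons (negbTE Pi) CP.
have [K KP] := bigO_onD _ _ _ (FO i Pi) (ex_intro _ C CP).
by exists K => z Ez; rewrite big_cons Pi KP.
Qed.

Lemma bigO_onX (L n : nat) (F : R * R -> R) : O L F -> O (L * n) (fun z => F z ^+ n).
Proof.
move=> FO; elim: n => [|n IHn]; first by rewrite muln0; exact: bigO_on_cst.
by rewrite mulnS; apply: (eq_bigO_on _ _ _ _ (bigO_onM _ _ _ _ FO IHn)) => z _; rewrite exprS.
Qed.

Lemma bigO_on_fst : O 1 (fun z => z.1).
Proof.
by exists 1 => z /E01/andP[z0 _]; rewrite mul1r expr1 ger0_norm// ltW.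
Qed.

(** Induction through F^(n+1) - G^(n+1) = F(F^n - G^n) + (F - G)G^n. *)
Lemma bigO_on_subX (L n : nat) (F G : R * R -> R) : O 0 F -> O 0 G ->
  O L (fun z => F z - G z) -> O L (fun z => F z ^+ n - G z ^+ n).
Proof.
move=> FO GO FGO; elim: n => [|n IHn].
  by exists 0 => z _; rewrite !expr0 subrr normr0 mul0r.
have H1 := bigO_onM _ _ _ _ FO IHn.
have H2 := bigO_onM _ _ _ _ FGO (bigO_onX _ n _ GO).
rewrite mul0n addn0 in H2.
by apply: (eq_bigO_on _ _ _ _ (bigO_onD _ _ _ H1 H2)) => z _; rewrite !exprS; ring.
Qed.

End BigO.

(** Doubling would equate an even and an odd number. *)
Lemma half_odd_neq_nat {R : realType} (k j : nat) : (k%:R - 2^-1 : R) != j%:R.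
Proof.
apply/eqP => H; have : (k.*2)%:R = (j.*2.+1)%:R :> R.
  by rewrite -natr1 -!muln2 !natrM -H; field.
by move/eqP; rewrite eqr_nat => /eqP; lia.
Qed.

(** With v = 1 - ts, (t - 1/s)^2 + c^2 = (v/s)^2 (1 + (cs/v)^2); as v/s > 0, the power k - 1/2 of
    (v/s)^2 is (v/s)^(2k-1). *)
Lemma multiquadric_invE {R : realType} (c s t : R) (k : nat) :
  0 < s -> 0 < 1 - t * s -> (0 < k)%N ->
  s ^+ (2 * k).-1 * multiquadric c k (t - s^-1) =
  (1 - t * s) ^+ (2 * k).-1 *
    (1 + (c * s / (1 - t * s)) ^+ 2) `^ (k%:R - 2^-1).
Proof.
move=> s0 v0 k0; rewrite /multiquadric; set v := 1 - t * s.
have -> : (t - s^-1) ^+ 2 + c ^+ 2 = (v / s) ^+ 2 * (1 + (c * s / v) ^+ 2).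
  rewrite /v; field.
  by rewrite !gt_eqF.
have vs0 : 0 <= v / s by rewrite divr_ge0 ?ltW.
rewrite powRM ?sqr_ge0 ?addr_ge0 ?sqr_ge0//.
rewrite -(powR_mulrn 2 vs0) -powRrM.
have -> : 2%:R * (k%:R - 2^-1) = (2 * k).-1%:R :> R.
  have -> : (2 * k).-1%:R = (2 * k)%:R - 1 :> R.
    by case: k k0 => // k _; rewrite -[in RHS](prednK (n := 2 * k.+1))// -natr1 addrK.
  by rewrite natrM; field.
rewrite powR_mulrn// exprMn exprVn mulrA mulrCA divff ?mulr1//.
by rewrite expf_neq0 ?gt_eqF.
Qed.

Definition geom {R : realType} (n : nat) : {poly R} := \poly_(i < n.+1) 1.

Lemma geom_horner {R : realType} (n : nat) (y : R) :
  (1 - y) * (geom n).[y] = 1 - y ^+ n.+1.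
Proof.
rewrite horner_poly -[RHS]opprB subrX1 -mulNr opprB; congr (_ * _).
by apply: eq_bigr => i _; rewrite mul1r.
Qed.

(* Approximates [(1 - X)^(2k-1-2i)]: exactly when the exponent is nonnegative, and up
   to [O(X^(n+1))] otherwise. *)
Definition mq_factor {R : realType} (k n i : nat) : {poly R} :=
  if (i < k)%N then (1 - 'X) ^+ (2 * k - 1 - 2 * i)
  else geom n ^+ (2 * i + 1 - 2 * k).

(** The i-th binomial term is a multiple of s^(2i) (1 - ts)^(2k-1-2i). Putting ts for the variable
    of [mq_factor] sends its l-th coefficient to t^l s^l, with t the inner variable and s the outer
    one. *)
Definition mq_expansion {R : realType} (c : R) (k n : nat) : {poly {poly R}} :=
  \sum_(i < (k + n).+1) 'X^(2 * i) *
    \poly_(l < size (mq_factor k n i : {poly R}))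
      ((gbinom (k%:R - 2^-1) i * c ^+ (2 * i) * (mq_factor k n i)`_l) *: 'X^l).

Lemma mq_expansion_horner {R : realType} (c : R) (k n : nat) (s t : R) :
  (mq_expansion c k n).[s%:P].[t] =
  \sum_(i < (k + n).+1) gbinom (k%:R - 2^-1) i * (c * s) ^+ (2 * i) *
    (mq_factor k n i).[t * s].
Proof.
rewrite !horner_sum; apply: eq_bigr => i _.
rewrite hornerM hornerXn -polyC_exp hornerM hornerC horner_poly horner_sum.
rewrite (horner_coef (mq_factor k n i)) !mulr_sumr; apply: eq_bigr => l _.
rewrite -polyC_exp hornerM hornerC hornerZ hornerXn !exprMn; ring.
Qed.

Lemma coef_mq_expansion {R : realType} (c : R) (k n m : nat) :
  (mq_expansion c k n)`_m =
  \sum_(i < (k + n).+1 | (2 * i <= m)%N)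
    (gbinom (k%:R - 2^-1) i * c ^+ (2 * i) * (mq_factor k n i)`_(m - 2 * i))
    *: 'X^(m - 2 * i).
Proof.
rewrite coef_sum [RHS]big_mkcond; apply: eq_bigr => i _.
rewrite coefXnM ltnNge; case: (2 * i <= m)%N => //=.
rewrite coef_poly; case: ltnP => // H.
by rewrite (nth_default 0 H) mulr0 scale0r.
Qed.

(** The bound on |ts| keeps 1 - ts at least 1/2; with cs <= 1/2 this gives cs/(1 - ts) <= 1, the
    range covered by [powR1D_taylor]. *)
Definition expansion_domain {R : realType} (c B : R) : set (R * R) :=
  [set z | [/\ 0 < z.1 <= 1, `|z.2| <= B, `|z.2 * z.1| <= 2^-1 &
              c * z.1 <= 2^-1]].

Section ExpansionError.
Context {R : realType} (c B : R) (k n : nat).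
Hypotheses (c0 : 0 < c) (k0 : (0 < k)%N).
Local Notation E := (expansion_domain c B).
Local Notation O := (bigO_on E).

Lemma expansion_domain_fst (z : R * R) : E z -> 0 < z.1 <= 1.
Proof. by case. Qed.
Local Notation E01 := expansion_domain_fst.

Lemma expansion_domain_base (z : R * R) : E z -> 2^-1 <= 1 - z.2 * z.1 <= 2.
Proof. by case=> _ _; rewrite ler_norml => /andP[h1 h2] _; lra. Qed.

Lemma bigO_on_base : O 0 (fun z => 1 - z.2 * z.1).
Proof.
exists 2 => z /expansion_domain_base/andP[h1 h2].
by rewrite expr0 mulr1 ger0_norm//; lra.
Qed.

Lemma bigO_on_base_inv : O 0 (fun z => (1 - z.2 * z.1)^-1).
Proof.
exists 2 => z /expansion_domain_base/andP[h1 h2].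
have v0 : 0 < 1 - z.2 * z.1 by lra.
rewrite expr0 mulr1 ger0_norm ?invr_ge0 ?(ltW v0)//.
by rewrite -[leRHS]invrK lef_pV2 ?posrE.
Qed.

Lemma bigO_on_snd_fst : O 1 (fun z => z.2 * z.1).
Proof.
exists B => z [/andP[z0 _] zB _ _].
by rewrite normrM expr1 (gtr0_norm z0) ler_wpM2r// ltW.
Qed.

(** The tail of the geometric series is y^(n+1)/(1 - y) with y = ts. *)
Lemma bigO_on_geom :
  O n.+1 (fun z => (1 - z.2 * z.1)^-1 - (geom n).[z.2 * z.1]).
Proof.
have := bigO_onM _ _ _ _ _ bigO_on_base_inv (bigO_onX _ _ n.+1 _ bigO_on_snd_fst).
rewrite add0n mul1n; apply: eq_bigO_on => z /expansion_domain_base/andP[h1 _].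
have v0 : 1 - z.2 * z.1 != 0 by rewrite gt_eqF//; lra.
apply: (mulfI v0); rewrite mulrBr geom_horner divff// mulrA divff// mul1r.
by rewrite opprB addrC subrK.
Qed.

(** For i < k the factor is exact. For i >= k, s^(2i) times the geometric error O(s^(n+1)) has order
    2i + n + 1 >= 2k + n + 1. *)
Lemma bigO_on_mq_factor (i : nat) : O (2 * k + n + 1) (fun z =>
  (c * z.1) ^+ (2 * i) * ((1 - z.2 * z.1) ^+ (2 * k).-1 *
    (1 - z.2 * z.1)^-1 ^+ (2 * i) - (mq_factor k n i).[z.2 * z.1])).
Proof.
rewrite /mq_factor; case: ltnP => ik.
  exists 0 => z /expansion_domain_base/andP[h1 _].
  have v0 : (1 - z.2 * z.1) \is a GRing.unit by rewrite unitfE gt_eqF//; lra.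
  rewrite horner_exp !hornerE exprVn.
  have -> : (2 * k).-1 = (2 * k - 1 - 2 * i + 2 * i)%N by lia.
  by rewrite exprD mulfK ?expf_neq0 -?unitfE// subrr mulr0 normr0.
have H1 : O (2 * i) (fun z => (c * z.1) ^+ (2 * i)).
  have := bigO_onX _ _ (2 * i) _ (bigO_onM _ _ _ _ _ (bigO_on_cst E c) (bigO_on_fst _ E01)).
  by rewrite add0n mul1n.
(* The truncated series is bounded, being 1/(1 - ts) minus its error. *)
have geomO : O 0 (fun z => (geom n).[z.2 * z.1]).
  have := bigO_onD _ _ _ _ bigO_on_base_inv
    (bigO_onM _ _ _ _ _ (bigO_on_cst E (-1)) (bigO_onW _ E01 _ _ _ (leq0n _) bigO_on_geom)).
  by apply: eq_bigO_on => z _; ring.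
have H2 := bigO_on_subX _ _ (2 * i + 1 - 2 * k) _ _ bigO_on_base_inv geomO bigO_on_geom.
apply: (bigO_onW _ E01 (2 * i + n.+1)); first by lia.
apply: (eq_bigO_on _ _ _ _ _ (bigO_onM _ _ _ _ _ H1 H2)) => z.
move=> /expansion_domain_base/andP[h1 _].
have v0 : 1 - z.2 * z.1 != 0 by rewrite gt_eqF//; lra.
congr (_ * (_ - _)); last by rewrite horner_exp.
have {2}-> : (2 * i = (2 * k).-1 + (2 * i + 1 - 2 * k))%N by lia.
by rewrite exprD mulrA -exprMn divff// expr1n mul1r.
Qed.

Lemma mq_expansion_error : O (2 * k + n + 1) (fun z =>
  z.1 ^+ (2 * k).-1 * multiquadric c k (z.2 - z.1^-1) -
  (mq_expansion c k n).[z.1%:P].[z.2]).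
Proof.
pose a : R := k%:R - 2^-1; pose w (z : R * R) := (c * z.1 / (1 - z.2 * z.1)) ^+ 2.
have [C CP] := powR1D_taylor (k + n).+1 a.
have wO : O 2 w.
  have := bigO_onX _ _ 2 _ (bigO_onM _ _ _ _ _ (bigO_onM _ _ _ _ _
    (bigO_on_cst E c) (bigO_on_fst _ E01)) bigO_on_base_inv).
  by rewrite add0n addn0 mul1n.
have w01 z : E z -> 0 <= w z <= 1.
  move=> Ez; have /andP[h1 _] := expansion_domain_base _ Ez.
  case: Ez => /andP[z0 _] _ _ cz; rewrite /w sqr_ge0/=.
  rewrite exprn_ile1 ?divr_ge0 ?mulr_ge0 ?(ltW c0) ?(ltW z0)//; try lra.
  by rewrite ler_pdivrMr; lra.
(* As w = O(s^2), the Taylor remainder of order k + n + 1 in w has order 2(k + n + 1) in s, beyond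
   the required 2k + n + 1. *)
have H1 : O (2 * (k + n).+1) (fun z =>
    (1 + w z) `^ a - (\poly_(i < (k + n).+1) gbinom a i).[w z]).
  have [K KP] := bigO_onX _ _ (k + n).+1 _ wO.
  exists (`|C| * K) => z Ez; apply: (le_trans (CP _ (w01 z Ez))).
  rewrite -mulrA; apply: (le_trans (ler_norm _)); rewrite normrM.
  by rewrite ler_wpM2l ?KP.
have H2 := bigO_onM _ _ _ _ _ (bigO_onX _ _ (2 * k).-1 _ bigO_on_base) H1.
have H3 : O (2 * k + n + 1) (fun z => \sum_(i < (k + n).+1) gbinom a i *
    ((c * z.1) ^+ (2 * i) * ((1 - z.2 * z.1) ^+ (2 * k).-1 *
    (1 - z.2 * z.1)^-1 ^+ (2 * i) - (mq_factor k n i).[z.2 * z.1]))).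
  apply: bigO_on_sum => i _.
  exact: (bigO_onM _ 0 _ _ _ (bigO_on_cst E _) (bigO_on_mq_factor i)).
have {}H2 := bigO_onW _ E01 _ (2 * k + n + 1) _ _ H2.
apply: (eq_bigO_on _ _ _ _ _ (bigO_onD _ _ _ _ (H2 _) H3)); last by lia.
move=> z Ez; have /andP[h1 _] := expansion_domain_base _ Ez.
have v0 : 0 < 1 - z.2 * z.1 by lra.
case: Ez => /andP[z0 _] _ _ _.
rewrite multiquadric_invE// mq_expansion_horner -/a -/(w z) horner_poly.
rewrite mulrBr -addrA; congr (_ + _).
rewrite mulr_sumr addrC -!sumrB -sumrN; apply: eq_bigr => i _.
by rewrite /w -exprM !exprMn; ring.
Qed.

End ExpansionError.

(** * Monomials in the closed span *)

(** The degree is at most 2k - 1 - 2i. Hence the terms i < k contribute nothing to the coefficient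
    of s^(2k+n). *)
Lemma coef_mq_factor_small {R : realType} (k n i m : nat) :
  (i < k)%N -> (2 * k - 2 * i <= m)%N -> (mq_factor k n i : {poly R})`_m = 0.
Proof.
move=> ik im; rewrite /mq_factor ik nth_default//.
have s2 : (size (1 - 'X : {poly R})%R <= 2)%N.
  by rewrite -size_polyN opprB size_XsubC.
apply: (leq_trans (size_poly_exp_leq _ _)).
by apply: leq_trans im; nia.
Qed.

Lemma coef_mq_factor_diag {R : realType} (k n : nat) :
  (mq_factor k n k : {poly R})`_n = 1.
Proof.
rewrite /mq_factor ltnn (_ : (2 * k + 1 - 2 * k = 1)%N); last by lia.
by rewrite expr1 coef_poly leqnn.
Qed.

Section MonomialsInClosure.
Context {R : realType} (c B : R) (k : nat) (e : nat -> R -> R) (y : nat -> R).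
Hypotheses (c0 : 0 < c) (k0 : (0 < k)%N) (yoo : y @ \oo --> +oo).
Hypothesis eE : forall j t, e j t = multiquadric c k (t - y j).
Local Notation W := (span_closure e [set t | `|t| <= B]).

Lemma mq_expansion_coef_closure (n : nat) :
  W (horner (mq_expansion c k n)`_(2 * k + n)).
Proof.
have [C CP] := mq_expansion_error c B k n c0 k0.
apply: (span_closure_coef _ _ `|C| (2 * k + n + 1)) => //; last by lia.
(* [D] dominates |B|, c and 1, so y_j > 2D places (1/y_j, t) in the expansion domain, and the extra
   1/d gives 1/y_j < d. *)
move=> d d0; pose D := `|B| + c + 1.
have D0 : 0 < D by rewrite ltr_pwDr ?addr_ge0 ?(ltW c0).
have : \forall j \near \oo, 2 * D + d^-1 < y j.
  by move/cvgryPgt: yoo; apply.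
move=> /filter_ex[j yj].
have d'0 : 0 < d^-1 by rewrite invr_gt0.
have y0 : 0 < y j by lra.
have yD : D * (y j)^-1 <= 2^-1 by rewrite ler_pdivrMr//; lra.
have s0 : 0 < (y j)^-1 by rewrite invr_gt0.
exists (y j)^-1, (fun t => (y j)^-1 ^+ (2 * k).-1 * e j t); split.
- by rewrite s0/= -[d]invrK ltf_pV2 ?posrE//; lra.
- by apply: span_closureZ; exact: span_closure_gen.
move=> t tB.
have Ez : expansion_domain c B ((y j)^-1, t).
  have BD : `|B| <= D by rewrite /D -addrA lerDl addr_ge0// ltW.
  have cD : c <= D by rewrite /D (addrC `|B|) -addrA lerDl addr_ge0.
  have D1 : 1 <= D by rewrite /D lerDr addr_ge0// ltW.
  have sD r : r <= D -> r * (y j)^-1 <= 2^-1.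
    by move=> rD; apply: le_trans yD; rewrite ler_wpM2r// ltW.
  split => //=.
  - by rewrite s0/=; have := sD 1 D1; lra.
  - rewrite normrM (gtr0_norm s0) sD// (le_trans tB)// (le_trans (ler_norm B))//.
  - exact: sD.
have := CP _ Ez; rewrite /= invrK -eE => H.
by apply: (le_trans H); rewrite ler_wpM2r ?ler_norm// exprn_ge0// ltW.
Qed.

(** Strong induction: in the coefficient of s^(2k+n), terms i < k vanish, i = k gives [b k * t ^+ n]
    with [b k] nonzero, and i > k gives degree 2k + n - 2i < n. Solving for t^n leaves only
    functions already in the closure. *)
Lemma monomial_closure (n : nat) : W (fun t => t ^+ n).
Proof.
elim/ltn_ind: n => n IHn.
pose b i : R := gbinom (k%:R - 2^-1) i * c ^+ (2 * i).
pose F (i : nat) t :=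
  b i * (mq_factor k n i : {poly R})`_(2 * k + n - 2 * i) * t ^+ (2 * k + n - 2 * i).
have bk : b k != 0.
  apply: mulf_neq0; last by rewrite expf_neq0 ?gt_eqF.
  by apply: gbinom_neq0 => j; exact: half_odd_neq_nat.
have kk : (k < (k + n).+1)%N by rewrite ltnS leq_addr.
have HQ t : ((mq_expansion c k n)`_(2 * k + n)).[t] = b k * t ^+ n +
    \sum_(i < (k + n).+1 | (2 * i <= 2 * k + n)%N && (i != Ordinal kk)) F i t.
  rewrite coef_mq_expansion horner_sum (bigD1 (Ordinal kk))/=; last by rewrite leq_addr.
  congr (_ + _); last by apply: eq_bigr => i _; rewrite hornerZ hornerXn.
  by rewrite hornerZ hornerXn addKn coef_mq_factor_diag mulr1.
have WF : W (fun t => \sum_(i < (k + n).+1 | (2 * i <= 2 * k + n)%N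
    && (i != Ordinal kk)) F i t).
  apply: span_closure_sum => i /andP[i2 ik].
  have [lik|] := ltnP i k.
    apply: (eq_span_closure _ _ _ _ _ (span_closure0 _ _)) => t _.
    by rewrite /F coef_mq_factor_small ?mulr0 ?mul0r// leq_sub2r// leq_addr.
  rewrite leq_eqVlt => /orP[/eqP ki|ki].
    by case/eqP: ik; apply: val_inj.
  by apply: span_closureZ; apply: IHn; lia.
have := span_closureD _ _ _ _ (mq_expansion_coef_closure n) (span_closureZ _ _ (-1) _ WF).
move=> /(span_closureZ _ _ (b k)^-1); apply: eq_span_closure => t _.
by rewrite HQ; field.
Qed.

Lemma poly_closure (p : {poly R}) : W (horner p).
Proof.
apply: (eq_span_closure _ _ (fun t => \sum_(i < size p) p`_i * t ^+ i)).
  by move=> t _; rewrite horner_coef.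
by apply: span_closure_sum => i _; apply: span_closureZ; exact: monomial_closure.
Qed.

End MonomialsInClosure.

Theorem theorem3p1 (R : realType) (c : R) (k : nat) (x : int -> R)
  (a b : R) (f : R -> R) (eps : R) :
  0 < c -> (0 < k)%N -> scattered x ->
  {within `[a, b], continuous f} -> 0 < eps ->
  exists (N : nat) (coef : nat -> R),
    sup [set `|f t - \sum_(1 <= j < N.+1) coef j * multiquadric c k (t - x j%:Z)|
        | t in `[a, b]] < eps.
Proof.
move=> c0 k0 [_ xoo _] fc e0; have e20 : 0 < eps / 2 by rewrite divr_gt0.
have e40 : 0 < eps / 2 / 2 by rewrite divr_gt0.
have [p pP] := weierstrass _ _ _ _ fc e40.
pose B := Num.max `|a| `|b|.
(* The span is indexed from 0 and the final sum from 1, hence the shift to [x j.+1] here and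
   [coef j.-1] below. *)
have yoo : (fun j : nat => x j.+1%:Z) @ \oo --> +oo.
  by have := xoo; rewrite -(cvg_shiftS (fun j : nat => x j%:Z)).
have [N [coef cP]] := @poly_closure R c B k
  (fun j t => multiquadric c k (t - x j.+1%:Z)) _ c0 k0 yoo (fun _ _ => erefl) p _ e40.
(* A pointwise bound gives only a non-strict bound on the supremum, so eps/2 is aimed at, split as
   eps/4 for each approximation. *)
exists N, (fun j => coef j.-1); apply: (@le_lt_trans _ _ (eps / 2)); last by lra.
have [ab|ba] := leP a b; last first.
  (* On an empty interval the supremum takes its default value 0. *)
  by rewrite set_itv_ge ?image_set0 ?sup0 ?ltW// bnd_simp -ltNge.
apply: ge_sup; first by exists (`|f a - \sum_(1 <= j < N.+1) coef j.-1 *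
  multiquadric c k (a - x j%:Z)|), a; rewrite //= in_itv/= lexx.
move=> _ [t /= tab <-].
have tB : `|t| <= B.
  move: tab; rewrite in_itv/= => /andP[at_ tb]; rewrite ler_norml /B.
  have := ler_norm b; have := ler_norm (- a); rewrite normrN.
  have : `|a| <= B by rewrite le_max lexx.
  have : `|b| <= B by rewrite le_max lexx orbT.
  by rewrite /B; lra.
rewrite big_add1/= big_mkord.
apply: (le_trans (ler_distD p.[t] _ _)); rewrite [leRHS]splitr.
by rewrite lerD ?pP ?cP.
Qed.
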